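(* Let $K_i=[a_i,b_i,c_i,d_i]$, $i=1,2,3$, be three oriented circles or lines, not all of which are straight lines, having a single common point in $\mathbb{R}^2$, with $\Delta_4\ne0$; here $U=0$. Consider the isogonal version of the Apollonius problem: to find the oriented circles (or lines) $K_0=K_0(\cos\Psi_0)=[a_0,b_0,c_0,d_0]$ with $1-2Q(K_i,K_0)=\cos\Psi_0$ for $i=1,2,3$, where $\cos\Psi_0$ is the real parameter of the family. The solution is given by $$a_0=\frac{G\cos^2\Psi_0-\frac14\Delta_4^2}{2V\cos\Psi_0},$$ with $b_0,c_0,d_0$ determined by $$b_0\Delta_4=a_0\Delta_2-\Delta_{ac}\cos\Psi_0,\qquad c_0\Delta_4=a_0\Delta_3+\Delta_{ab}\cos\Psi_0,\qquad d_0\Delta_4=a_0\Delta_1-2\Delta_{bc}\cos\Psi_0.$$ The intersection angle $\Psi$ of two solutions $K_0(\cos\Psi_1)$ and $K_0(\cos\Psi_2)$ (where $\Psi_1,\Psi_2$ are two values of $\Psi_0$) satisfies $$\cos\Psi=\frac12\left(\frac{\cos\Psi_1}{\cos\Psi_2}+\frac{\cos\Psi_2}{\cos\Psi_1}\right).$$ Since $|\cos\Psi|>1$, the pencil of solutions is hyperbolic.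
   Context: An oriented circle or line is a quadruple of reals $K=[a,b,c,d]$ with $b^2+c^2-ad=1$, representing the curve $N(x,y)=a(x^2+y^2)+2bx+2cy+d=0$. Here $a$ is its signed curvature: for $a\ne0$ it is the circle of radius $1/|a|$ centred at $(-b/a,-c/a)$, for $a=0$ it is a straight line. The orientation is such that points with $N<0$ lie to the left of the curve. The inversive invariant of two oriented circles or lines is defined by $4Q(K_1,K_2)=2+a_1d_2+a_2d_1-2(b_1b_2+c_1c_2)$; their intersection angle $\Psi$ is given by $\cos\Psi=1-2Q(K_1,K_2)$. It may be imaginary: if the two circles do not intersect, then $|\cos\Psi|>1$. Imaginary values of $\Psi_0$, with $|\cos\Psi_0|>1$, are included in the family of solutions. A pencil is a family of circles/lines every member of which is a linear combination of two others (in terms of the quadruples, normalized so that $b^2+c^2-ad=1$); it is hyperbolic if the two common points of its circles are complex (non-real). Notation for a triple $K_1,K_2,K_3$: $Q_1=Q(K_1,K_2)$, $Q_2=Q(K_2,K_3)$, $Q_3=Q(K_3,K_1)$; $U=Q_1^2+Q_2^2+Q_3^2-2(Q_1Q_2+Q_2Q_3+Q_3Q_1)+4Q_1Q_2Q_3$; $v_i=Q_i(Q_i-Q_j-Q_k)$ for $\{i,j,k\}=\{1,2,3\}$; $V=a_1v_2+a_2v_3+a_3v_1$; $$G=Q_1(a_1-a_3)(a_2-a_3)+Q_2(a_2-a_1)(a_3-a_1)+Q_3(a_3-a_2)(a_1-a_2).$$ Writing $\det(p_i\ q_i\ r_i)$ for the $3\times3$ determinant whose $i$-th row is $(p_i,q_i,r_i)$,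 $i=1,2,3$: $\Delta_4=\det(a_i\ b_i\ c_i)$, $\Delta_1=-\det(b_i\ c_i\ d_i)$, $\Delta_2=-\tfrac12\det(a_i\ c_i\ d_i)$, $\Delta_3=\tfrac12\det(a_i\ b_i\ d_i)$, $\Delta_{ab}=\det(a_i\ b_i\ 1)$, $\Delta_{ac}=\det(a_i\ c_i\ 1)$, $\Delta_{bc}=\det(b_i\ c_i\ 1)$.
   Formalization: The quotient formula for a_0 is stated only when V cosΨ_0 ≠ 0, hyperbolicity of the pencil only when V ≠ 0 (for V = 0 the pencil is parabolic), and |cosΨ| > 1 only when |cosΨ_1| ≠ |cosΨ_2| (otherwise |cosΨ| = 1). *)

(* Defs.v *)
(* Stdlib reals, with Coquelicot for the complex numbers C. *)
From Stdlib Require Import Reals.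
From Coquelicot Require Import Coquelicot.
Open Scope R_scope.

Record quad (T : Type) : Type := Quad { qa : T; qb : T; qc : T; qd : T }.
Arguments Quad {T}.
Arguments qa {T}.
Arguments qb {T}.
Arguments qc {T}.
Arguments qd {T}.

(* [K] is an oriented circle or line. *)
Definition oriented (K : quad R) : Prop :=
  qb K ^ 2 + qc K ^ 2 - qa K * qd K = 1.

Definition is_line (K : quad R) : Prop := qa K = 0.

Definition curveN (K : quad R) (x y : R) : R :=
  qa K * (x ^ 2 + y ^ 2) + 2 * qb K * x + 2 * qc K * y + qd K.

Definition on_curve (K : quad R) (p : R * R) : Prop :=
  curveN K (fst p) (snd p) = 0.

Definition invQ (K L : quad R) : R :=
  (2 + qa K * qd L + qa L * qd K - 2 * (qb K * qb L + qc K * qc L)) / 4.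

(* Only the cosine of the intersection angle is used: it is real even when the
   angle itself is imaginary. *)
Definition cos_angle (K L : quad R) : R := 1 - 2 * invQ K L.

(* Invariants of a triple; Q1, Q2, Q3 belong to the pairs (1,2), (2,3), (3,1). *)

Definition tripleU (K1 K2 K3 : quad R) : R :=
  let Q1 := invQ K1 K2 in let Q2 := invQ K2 K3 in let Q3 := invQ K3 K1 in
  Q1 ^ 2 + Q2 ^ 2 + Q3 ^ 2 - 2 * (Q1 * Q2 + Q2 * Q3 + Q3 * Q1)
  + 4 * Q1 * Q2 * Q3.

Definition tripleV (K1 K2 K3 : quad R) : R :=
  let Q1 := invQ K1 K2 in let Q2 := invQ K2 K3 in let Q3 := invQ K3 K1 in
  let v1 := Q1 * (Q1 - Q2 - Q3) in
  let v2 := Q2 * (Q2 - Q3 - Q1) in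
  let v3 := Q3 * (Q3 - Q1 - Q2) in
  qa K1 * v2 + qa K2 * v3 + qa K3 * v1.

Definition tripleG (K1 K2 K3 : quad R) : R :=
  let Q1 := invQ K1 K2 in let Q2 := invQ K2 K3 in let Q3 := invQ K3 K1 in
  let a1 := qa K1 in let a2 := qa K2 in let a3 := qa K3 in
  Q1 * (a1 - a3) * (a2 - a3) + Q2 * (a2 - a1) * (a3 - a1)
  + Q3 * (a3 - a2) * (a1 - a2).

Definition det3 (p1 q1 r1 p2 q2 r2 p3 q3 r3 : R) : R :=
  p1 * (q2 * r3 - r2 * q3) - q1 * (p2 * r3 - r2 * p3)
  + r1 * (p2 * q3 - q2 * p3).

(* The determinant whose i-th row is (p K_i, q K_i, r K_i). *)
Definition rows_det (p q r : quad R -> R) (K1 K2 K3 : quad R) : R :=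
  det3 (p K1) (q K1) (r K1) (p K2) (q K2) (r K2) (p K3) (q K3) (r K3).

Definition one_entry (K : quad R) : R := 1.

Definition Delta1 (K1 K2 K3 : quad R) : R := - rows_det qb qc qd K1 K2 K3.
Definition Delta2 (K1 K2 K3 : quad R) : R := - / 2 * rows_det qa qc qd K1 K2 K3.
Definition Delta3 (K1 K2 K3 : quad R) : R := / 2 * rows_det qa qb qd K1 K2 K3.
Definition Delta4 (K1 K2 K3 : quad R) : R := rows_det qa qb qc K1 K2 K3.
Definition Delta_ab (K1 K2 K3 : quad R) : R := rows_det qa qb one_entry K1 K2 K3.
Definition Delta_ac (K1 K2 K3 : quad R) : R := rows_det qa qc one_entry K1 K2 K3.
Definition Delta_bc (K1 K2 K3 : quad R) : R := rows_det qb qc one_entry K1 K2 K3.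

(* [K0] solves the isogonal Apollonius problem with cos Psi_0 = t. *)
Definition isogonal (K1 K2 K3 : quad R) (t : R) (K0 : quad R) : Prop :=
  oriented K0 /\
  cos_angle K1 K0 = t /\ cos_angle K2 K0 = t /\ cos_angle K3 K0 = t.

(* The linear relations giving b0, c0, d0 in terms of a0. *)
Definition bcd_relations (K1 K2 K3 : quad R) (t : R) (K0 : quad R) : Prop :=
  qb K0 * Delta4 K1 K2 K3 =
    qa K0 * Delta2 K1 K2 K3 - Delta_ac K1 K2 K3 * t /\
  qc K0 * Delta4 K1 K2 K3 =
    qa K0 * Delta3 K1 K2 K3 + Delta_ab K1 K2 K3 * t /\
  qd K0 * Delta4 K1 K2 K3 =
    qa K0 * Delta1 K1 K2 K3 - 2 * Delta_bc K1 K2 K3 * t.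

Definition lincomb (l : R) (K : quad R) (m : R) (L : quad R) : quad R :=
  Quad (l * qa K + m * qa L) (l * qb K + m * qb L)
       (l * qc K + m * qc L) (l * qd K + m * qd L).

Definition independent (K L : quad R) : Prop :=
  forall l m : R, lincomb l K m L = Quad 0 0 0 0 -> l = 0 /\ m = 0.

(* All oriented circles and lines that are linear combinations of two given
   ones, each curve occurring with both of its orientations. *)
Definition is_pencil (F : quad R -> Prop) : Prop :=
  exists K L : quad R,
    oriented K /\ oriented L /\ independent K L /\
    forall X : quad R,
      F X <-> oriented X /\ exists l m : R, X = lincomb l K m L.

(* Points of the complexified inversive plane: nonzero isotropic quadruples over
   C up to a nonzero factor.  The affine point (x, y) is the quadruple
   [1, -x, -y, x^2 + y^2], for which incidence with K reads N(x, y) = 0; the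
   points with first entry 0 lie at infinity.  The latter are needed because the
   two common points of a concentric pencil centred at (x0, y0) are
   [0, 1, i, -2 (x0 + i y0)] and its conjugate. *)
Definition is_cpoint (P : quad C) : Prop :=
  P <> Quad (RtoC 0) (RtoC 0) (RtoC 0) (RtoC 0) /\
  (qb P * qb P + qc P * qc P - qa P * qd P = 0)%C.

Definition same_cpoint (P P' : quad C) : Prop :=
  exists z : C, z <> RtoC 0 /\
    P' = Quad (z * qa P)%C (z * qb P)%C (z * qc P)%C (z * qd P)%C.

Definition real_cpoint (P : quad C) : Prop :=
  exists X : quad R,
    same_cpoint P (Quad (RtoC (qa X)) (RtoC (qb X)) (RtoC (qc X)) (RtoC (qd X))).

Definition incident (K : quad R) (P : quad C) : Prop :=
  (RtoC (qa K) * qd P + RtoC (qd K) * qa P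
   - RtoC 2 * (RtoC (qb K) * qb P + RtoC (qc K) * qc P) = 0)%C.

Definition hyperbolic_pencil (F : quad R -> Prop) : Prop :=
  is_pencil F /\
  exists P P' : quad C,
    is_cpoint P /\ is_cpoint P' /\ ~ same_cpoint P P' /\
    (forall X : quad C, is_cpoint X ->
       ((forall K : quad R, F K -> incident K X) <->
        same_cpoint P X \/ same_cpoint P' X)) /\
    ~ real_cpoint P /\ ~ real_cpoint P'.

(* Main.v *)
Require Import Defs.
From Stdlib Require Import Reals Lra.
From Coquelicot Require Import Coquelicot.
Open Scope R_scope.

(** The form [inner K L = b b' + c c' - (a d' + a' d) / 2] has signature (3,1)
    on quadruples; an oriented curve is a vector of square 1, the inner product
    of two of them is the cosine of their angle, and a point (x, y) of the plane
    is the isotropic vector [E = [1, -x, -y, x^2 + y^2]], orthogonal to exactly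
    the curves through it.  If [K1, K2, K3] pass through (x, y), their span,
    three-dimensional because [Delta4 <> 0], is the orthogonal complement of the
    isotropic vector [E].  Hence their Gram determinant, which is [-4 U],
    vanishes ([tripleU_normal]).

    The three conditions [inner Ki K0 = t] are linear in [K0], and Cramer's rule
    turns them into the relations for [b0, c0, d0]; as the kernel is spanned by
    [E], they say [K0 = a0 E + t F] with a fixed vector [F] whose first entry is
    0 ([isogonal_span]).  What remains is that [K0] has square 1, that is
    [2 a0 t (E.F) + t^2 (F.F) = 1].  The products are [E.F = -4 V / Delta4^2] and
    [F.F = 4 G / Delta4^2] ([tripleV_det], [tripleG_det]), which gives the
    equation for [a0].  It forces [t <> 0]; it also gives
    [a0 (E.F) = (1 / t - t (F.F)) / 2], and substituting this in
    [K.L = (a_K t2 + a_L t1) (E.F) + t1 t2 (F.F)] cancels [F.F] and leaves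
    [(t1 / t2 + t2 / t1) / 2].

    If [V <> 0], the solutions are thus all the unit vectors of the plane spanned
    by [E] and [F], which has signature (1,1).  Its orthogonal complement is
    positive definite, so that over the complex numbers it has two isotropic
    lines, conjugate to each other and not real: they are the common points of
    the pencil ([isotropic_plane_hyperbolic]). *)

(** * The inversive inner product *)

Definition inner (K L : quad R) : R :=
  qb K * qb L + qc K * qc L - (qa K * qd L + qa L * qd K) / 2.

Lemma cos_angle_inner K L : cos_angle K L = inner K L.
Proof. unfold cos_angle, invQ, inner; field. Qed.

Lemma invQ_inner K L : invQ K L = (1 - inner K L) / 2.
Proof. unfold invQ, inner; field. Qed.

Lemma oriented_inner K : oriented K <-> inner K K = 1.
Proof. unfold oriented, inner; split; intro H; lra. Qed.

Lemma inner_sym K L : inner K L = inner L K.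
Proof. unfold inner; field. Qed.

Lemma inner_lincomb_l l K m L M :
  inner (lincomb l K m L) M = l * inner K M + m * inner L M.
Proof. unfold inner, lincomb; simpl; field. Qed.

Lemma inner_lincomb l m l' m' E F :
  inner (lincomb l E m F) (lincomb l' E m' F) =
  l * l' * inner E E + (l * m' + l' * m) * inner E F + m * m' * inner F F.
Proof. unfold inner, lincomb; simpl; field. Qed.

Lemma quad_ext (K L : quad R) :
  qa K = qa L -> qb K = qb L -> qc K = qc L -> qd K = qd L -> K = L.
Proof. destruct K, L; simpl; intros; subst; reflexivity. Qed.

(** The isotropic vector of the point (x, y). *)
Definition point_quad (x y : R) : quad R := Quad 1 (- x) (- y) (x ^ 2 + y ^ 2).

Lemma inner_point x y : inner (point_quad x y) (point_quad x y) = 0.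
Proof. unfold inner, point_quad; simpl; field. Qed.

(** * Determinants and the invariants of a triple *)

(** [Delta4, Delta2, Delta3, Delta1] are the entries of a vector normal to the
    triple; its square is minus the Gram determinant of the triple, which for
    three unit vectors is [-4 U]. *)
Lemma tripleU_normal K1 K2 K3 :
  oriented K1 -> oriented K2 -> oriented K3 ->
  4 * tripleU K1 K2 K3 =
  Delta2 K1 K2 K3 ^ 2 + Delta3 K1 K2 K3 ^ 2 - Delta4 K1 K2 K3 * Delta1 K1 K2 K3.
Proof.
  rewrite !oriented_inner; intros H1 H2 H3.
  assert (gram : inner K1 K1 * inner K2 K2 * inner K3 K3
    + 2 * inner K1 K2 * inner K2 K3 * inner K3 K1
    - inner K1 K1 * inner K2 K3 ^ 2 - inner K2 K2 * inner K3 K1 ^ 2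
    - inner K3 K3 * inner K1 K2 ^ 2 =
    - (Delta2 K1 K2 K3 ^ 2 + Delta3 K1 K2 K3 ^ 2
       - Delta4 K1 K2 K3 * Delta1 K1 K2 K3)).
  { unfold inner, Delta1, Delta2, Delta3, Delta4, rows_det, det3; field. }
  rewrite H1, H2, H3 in gram.
  unfold tripleU; rewrite !invQ_inner; lra.
Qed.

(** The row sums of the adjugate of the Gram matrix of three unit vectors are
    [-4 v2, -4 v3, -4 v1], so [-4 V] is the first entry of the combination of
    [K1, K2, K3] with these coefficients.  If the Gram determinant [g] is not 0,
    this combination is [g f], where [f] lies in the span of the triple and
    [inner f Ki = 1].  Let [n] be the normal vector of [tripleU_normal], with
    [n.n = - g], and let [F] be the multiple of
    [0, - Delta_ac, Delta_ab, - 2 Delta_bc] with [inner F Ki = 1].  Then [F] is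
    [f - (a_f / Delta4) n], whence [Delta4 (n.F) = g a_f], which is the formula.
    Being polynomial, it also holds when [g = 0]. *)
Lemma tripleV_det K1 K2 K3 :
  oriented K1 -> oriented K2 -> oriented K3 ->
  - 4 * tripleV K1 K2 K3 =
  - Delta2 K1 K2 K3 * Delta_ac K1 K2 K3 + Delta3 K1 K2 K3 * Delta_ab K1 K2 K3
  + Delta4 K1 K2 K3 * Delta_bc K1 K2 K3.
Proof.
  rewrite !oriented_inner; intros H1 H2 H3.
  assert (adj :
    qa K1 * (inner K2 K2 * inner K3 K3 - inner K2 K3 ^ 2
             + inner K3 K1 * inner K2 K3 - inner K1 K2 * inner K3 K3
             + inner K1 K2 * inner K2 K3 - inner K3 K1 * inner K2 K2)
    + qa K2 * (inner K3 K3 * inner K1 K1 - inner K3 K1 ^ 2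
             + inner K1 K2 * inner K3 K1 - inner K2 K3 * inner K1 K1
             + inner K2 K3 * inner K3 K1 - inner K1 K2 * inner K3 K3)
    + qa K3 * (inner K1 K1 * inner K2 K2 - inner K1 K2 ^ 2
             + inner K2 K3 * inner K1 K2 - inner K3 K1 * inner K2 K2
             + inner K3 K1 * inner K1 K2 - inner K2 K3 * inner K1 K1) =
    - Delta2 K1 K2 K3 * Delta_ac K1 K2 K3 + Delta3 K1 K2 K3 * Delta_ab K1 K2 K3
    + Delta4 K1 K2 K3 * Delta_bc K1 K2 K3).
  { unfold inner, Delta2, Delta3, Delta4, Delta_ab, Delta_ac, Delta_bc,
      rows_det, det3, one_entry; field. }
  rewrite H1, H2, H3 in adj; rewrite <- adj.
  unfold tripleV; rewrite !invQ_inner; field.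
Qed.

(** For unit vectors [4 Q] is the square of the difference of the two, so that
    [4 G] is the square of [(a2 - a3) (K1 - K3) - (a1 - a3) (K2 - K3)], a vector
    with first entry 0 and next two entries [Delta_ab], [Delta_ac] up to sign
    and order. *)
Lemma tripleG_det K1 K2 K3 :
  oriented K1 -> oriented K2 -> oriented K3 ->
  4 * tripleG K1 K2 K3 = Delta_ac K1 K2 K3 ^ 2 + Delta_ab K1 K2 K3 ^ 2.
Proof.
  intros H1 H2 H3.
  assert (diff : forall K L, oriented K -> oriented L ->
    invQ K L = ((qb K - qb L) ^ 2 + (qc K - qc L) ^ 2
                - (qa K - qa L) * (qd K - qd L)) / 4).
  { unfold oriented, invQ; intros K L HK HL; lra. }
  unfold tripleG; rewrite !diff by assumption.
  unfold Delta_ab, Delta_ac, rows_det, det3, one_entry; field.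
Qed.

(** * The linear conditions *)

(** Cramer's rule for the unknowns [b0, c0, d0], with [a0] as a parameter. *)
Lemma cramer K1 K2 K3 t K0 :
  Delta4 K1 K2 K3 <> 0 ->
  (inner K1 K0 = t /\ inner K2 K0 = t /\ inner K3 K0 = t <->
   bcd_relations K1 K2 K3 t K0).
Proof.
  intro D0; unfold bcd_relations; split.
  - intros (h1 & h2 & h3).
    assert (b : qb K0 * Delta4 K1 K2 K3 = qa K0 * Delta2 K1 K2 K3
      - det3 (qa K1) (qc K1) (inner K1 K0) (qa K2) (qc K2) (inner K2 K0)
             (qa K3) (qc K3) (inner K3 K0))
      by (unfold inner, Delta2, Delta4, rows_det, det3; field).
    assert (c : qc K0 * Delta4 K1 K2 K3 = qa K0 * Delta3 K1 K2 K3
      + det3 (qa K1) (qb K1) (inner K1 K0) (qa K2) (qb K2) (inner K2 K0)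
             (qa K3) (qb K3) (inner K3 K0))
      by (unfold inner, Delta3, Delta4, rows_det, det3; field).
    assert (d : qd K0 * Delta4 K1 K2 K3 = qa K0 * Delta1 K1 K2 K3
      - 2 * det3 (qb K1) (qc K1) (inner K1 K0) (qb K2) (qc K2) (inner K2 K0)
             (qb K3) (qc K3) (inner K3 K0))
      by (unfold inner, Delta1, Delta4, rows_det, det3; field).
    rewrite h1, h2, h3 in b, c, d; rewrite b, c, d.
    unfold Delta_ab, Delta_ac, Delta_bc, rows_det, det3, one_entry.
    repeat split; ring.
  - intros (hb & hc & hd).
    assert (scale : forall K, inner K K0 * Delta4 K1 K2 K3 =
      qb K * (qb K0 * Delta4 K1 K2 K3) + qc K * (qc K0 * Delta4 K1 K2 K3)
      - (qa K * (qd K0 * Delta4 K1 K2 K3) + qa K0 * Delta4 K1 K2 K3 * qd K) / 2)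
      by (intro K; unfold inner; field).
    repeat split; apply (Rmult_eq_reg_r (Delta4 K1 K2 K3)); try exact D0;
      rewrite scale, hb, hc, hd;
      unfold Delta1, Delta2, Delta3, Delta4, Delta_ab, Delta_ac, Delta_bc,
        rows_det, det3, one_entry; field.
Qed.

(** The solution of the three linear conditions with [t = 1] and [a0 = 0]. *)
Definition slope_quad (K1 K2 K3 : quad R) : quad R :=
  Quad 0 (- Delta_ac K1 K2 K3 / Delta4 K1 K2 K3)
       (Delta_ab K1 K2 K3 / Delta4 K1 K2 K3)
       (- 2 * Delta_bc K1 K2 K3 / Delta4 K1 K2 K3).

(** A curve through (x, y) has [d = - a (x^2 + y^2) - 2 b x - 2 c y]; expanding
    the determinants along the column of the [d] shows that the vector normal to
    the triple is [Delta4] times the isotropic vector of the common point. *)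
Lemma normal_common_point K1 K2 K3 x y :
  curveN K1 x y = 0 -> curveN K2 x y = 0 -> curveN K3 x y = 0 ->
  Delta2 K1 K2 K3 = - x * Delta4 K1 K2 K3 /\
  Delta3 K1 K2 K3 = - y * Delta4 K1 K2 K3 /\
  Delta1 K1 K2 K3 = (x ^ 2 + y ^ 2) * Delta4 K1 K2 K3.
Proof.
  assert (solve_d : forall K, curveN K x y = 0 ->
    qd K = - qa K * (x ^ 2 + y ^ 2) - 2 * qb K * x - 2 * qc K * y)
    by (unfold curveN; intros; lra).
  intros h1%solve_d h2%solve_d h3%solve_d.
  unfold Delta1, Delta2, Delta3, Delta4, rows_det, det3; rewrite h1, h2, h3.
  repeat split; field.
Qed.

Lemma isogonal_span K1 K2 K3 x y t K0 :
  curveN K1 x y = 0 -> curveN K2 x y = 0 -> curveN K3 x y = 0 ->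
  Delta4 K1 K2 K3 <> 0 ->
  (bcd_relations K1 K2 K3 t K0 <->
   K0 = lincomb (qa K0) (point_quad x y) t (slope_quad K1 K2 K3)).
Proof.
  intros h1 h2 h3 D0.
  destruct (normal_common_point _ _ _ _ _ h1 h2 h3) as (n2 & n3 & n1).
  unfold bcd_relations; rewrite n1, n2, n3; split.
  - intros (hb & hc & hd); apply quad_ext; simpl; [ring | | |];
      apply (Rmult_eq_reg_r (Delta4 K1 K2 K3)); try exact D0;
      rewrite ?hb, ?hc, ?hd; field; exact D0.
  - intro e; rewrite e at 1 3 5; simpl.
    repeat split; field; exact D0.
Qed.

(** * Common points of a plane of curves *)

Lemma Cminus_eq0 (z w : C) : (z - w = RtoC 0)%C -> z = w.
Proof. intro h; rewrite <- (Cplus_0_r w), <- h; ring. Qed.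

Lemma quad_extC (P X : quad C) :
  qa P = qa X -> qb P = qb X -> qc P = qc X -> qd P = qd X -> P = X.
Proof. destruct P, X; simpl; intros; subst; reflexivity. Qed.

Lemma RtoC2_neq0 : RtoC 2 <> RtoC 0.
Proof. intro k; apply RtoC_inj in k; lra. Qed.

Lemma Ci_square : (Ci * Ci = - RtoC 1)%C.
Proof. apply injective_projections; simpl; ring. Qed.

Lemma incident_lincomb l K m L P :
  incident K P -> incident L P -> incident (lincomb l K m L) P.
Proof.
  unfold incident; intros hK hL.
  assert (e : forall A B : C, A = RtoC 0 -> B = RtoC 0 ->
    (RtoC l * A + RtoC m * B = RtoC 0)%C)
    by (intros A B -> ->; ring).
  rewrite <- (e _ _ hK hL); simpl; rewrite !RtoC_plus, !RtoC_mult; ring.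
Qed.

Lemma incident_point x y P :
  incident (point_quad x y) P <->
  (qd P = - (RtoC x * RtoC x + RtoC y * RtoC y) * qa P
          - RtoC 2 * (RtoC x * qb P + RtoC y * qc P))%C.
Proof.
  unfold incident, point_quad; simpl.
  rewrite RtoC_plus, !RtoC_mult, !RtoC_opp; split; intro h.
  - apply Cminus_eq0; rewrite <- h; ring.
  - rewrite h; ring.
Qed.

(** Translating (x, y) to the origin replaces the entries [b], [c] of a quadruple
    by [b + x a], [c + y a].  For a quadruple orthogonal to the isotropic vector
    of (x, y), they are the only entries that occur in the square. *)
Lemma square_at_point x y P :
  incident (point_quad x y) P ->
  (qb P * qb P + qc P * qc P - qa P * qd P =
   (qb P + RtoC x * qa P) * (qb P + RtoC x * qa P)
   + (qc P + RtoC y * qa P) * (qc P + RtoC y * qa P))%C.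
Proof. intros h%incident_point; rewrite h; ring. Qed.

(** In the same translated entries, the remaining linear condition determines
    [a] when the inner product is nonzero. *)
Lemma incident_slope x y f g h P :
  incident (Quad 0 f g h) P <->
  (RtoC (inner (point_quad x y) (Quad 0 f g h)) * qa P =
   - (RtoC f * (qb P + RtoC x * qa P) + RtoC g * (qc P + RtoC y * qa P)))%C.
Proof.
  assert (e : (RtoC 0 * qd P + RtoC h * qa P
      - RtoC 2 * (RtoC f * qb P + RtoC g * qc P) =
    - RtoC 2 * (RtoC (inner (point_quad x y) (Quad 0 f g h)) * qa P
     - - (RtoC f * (qb P + RtoC x * qa P) + RtoC g * (qc P + RtoC y * qa P))))%C).
  { replace (inner (point_quad x y) (Quad 0 f g h)) with (- x * f - y * g - h * / 2)
      by (unfold inner; simpl; field).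
    rewrite !RtoC_minus, !RtoC_mult, RtoC_opp, RtoC_inv by lra.
    field; exact RtoC2_neq0. }
  unfold incident; simpl; rewrite e; split; intro k.
  - apply Cminus_eq0.
    destruct (Ceq_dec (RtoC (inner (point_quad x y) (Quad 0 f g h)) * qa P
      - - (RtoC f * (qb P + RtoC x * qa P) + RtoC g * (qc P + RtoC y * qa P)))
      (RtoC 0)) as [z | nz]; [exact z | exfalso].
    apply (Cmult_neq_0 _ _ RtoC2_neq0 nz).
    transitivity (- RtoC 0)%C; [rewrite <- k |]; ring.
  - rewrite k; ring.
Qed.

(** The vector orthogonal to the plane with translated entries [b + x a = 1] and
    [c + y a = s]; it is isotropic for [s = i] and [s = - i]. *)
Definition isotropic_normal (x y f g h : R) (s : C) : quad C :=
  let a := (- (RtoC f + RtoC g * s)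
            / RtoC (inner (point_quad x y) (Quad 0 f g h)))%C in
  let b := (RtoC 1 - RtoC x * a)%C in
  let c := (s - RtoC y * a)%C in
  Quad a b c (- (RtoC x * RtoC x + RtoC y * RtoC y) * a
              - RtoC 2 * (RtoC x * b + RtoC y * c))%C.

Section Isotropic_normal.

Variables x y f g h : R.
Let E := point_quad x y.
Let F := Quad 0 f g h.
Let N := isotropic_normal x y f g h.
Hypothesis EF : inner E F <> 0.

Lemma isotropic_normal_b s : (qb (N s) + RtoC x * qa (N s) = RtoC 1)%C.
Proof. unfold N, isotropic_normal; cbv zeta; cbn [qa qb]; ring. Qed.

Lemma isotropic_normal_c s : (qc (N s) + RtoC y * qa (N s) = s)%C.
Proof. unfold N, isotropic_normal; cbv zeta; cbn [qa qc]; ring. Qed.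

Lemma isotropic_normal_incident s : incident E (N s) /\ incident F (N s).
Proof.
  split.
  - apply incident_point; reflexivity.
  - apply (incident_slope x y).
    rewrite isotropic_normal_b, isotropic_normal_c.
    unfold N, isotropic_normal; cbn [qa]; field.
    intro k; apply RtoC_inj in k; exact (EF k).
Qed.

Lemma isotropic_normal_cpoint s : (s * s = - RtoC 1)%C -> is_cpoint (N s).
Proof.
  intro ss; split.
  - intro z; pose proof (isotropic_normal_b s) as b; rewrite z in b; simpl in b.
    assert (k : RtoC 0 = RtoC 1) by (rewrite <- b; ring).
    apply RtoC_inj in k; lra.
  - rewrite (square_at_point x y) by apply isotropic_normal_incident.
    rewrite isotropic_normal_b, isotropic_normal_c, ss; ring.
Qed.

(** Scaling is visible in the translated entries, because they are linear. *)
Lemma isotropic_normal_scale s z P :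
  P = Quad (z * qa (N s))%C (z * qb (N s))%C (z * qc (N s))%C (z * qd (N s))%C ->
  (qb P + RtoC x * qa P = z)%C /\ (qc P + RtoC y * qa P = z * s)%C.
Proof.
  intros ->; cbn [qa qb qc]; split.
  - transitivity (z * (qb (N s) + RtoC x * qa (N s)))%C; [ring |].
    rewrite isotropic_normal_b; ring.
  - transitivity (z * (qc (N s) + RtoC y * qa (N s)))%C; [ring |].
    rewrite isotropic_normal_c; ring.
Qed.

Lemma isotropic_normal_neq s s' : s <> s' -> ~ same_cpoint (N s) (N s').
Proof.
  intros ne (z & _ & e); destruct (isotropic_normal_scale _ _ _ e) as (b & c).
  rewrite isotropic_normal_b in b; rewrite isotropic_normal_c in c.
  apply ne; rewrite c, <- b; ring.
Qed.

(** A real multiple would make both [z] and [z s] real. *)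
Lemma isotropic_normal_not_real s : Im s <> 0 -> ~ real_cpoint (N s).
Proof.
  intros im (X & z & nz & e); destruct (isotropic_normal_scale _ _ _ e) as (b & c).
  cbn [qa qb qc] in b, c.
  rewrite <- !RtoC_mult, <- !RtoC_plus in b, c.
  rewrite <- b in c, nz.
  apply (f_equal Im) in c; simpl in c.
  apply nz, f_equal.
  apply (Rmult_eq_reg_r (Im s)); [unfold Im in *; lra | exact im].
Qed.

(** On the orthogonal complement of the plane the square is the sum of the
    squares of the translated entries, hence the product of two linear forms. *)
Lemma isotropic_normal_all P :
  is_cpoint P -> incident E P -> incident F P ->
  same_cpoint (N Ci) P \/ same_cpoint (N (- Ci)%C) P.
Proof.
  intros (nz & sq) hE hF.
  pose proof hE as hE'; apply incident_point in hE'.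
  pose proof hF as hF'; apply (incident_slope x y) in hF'.
  rewrite (square_at_point x y) in sq by exact hE.
  set (b := (qb P + RtoC x * qa P)%C) in *.
  set (c := (qc P + RtoC y * qa P)%C) in *.
  assert (EFC : RtoC (inner (point_quad x y) (Quad 0 f g h)) <> RtoC 0)
    by (intro k; apply RtoC_inj in k; exact (EF k)).
  assert (ha : qa P = (- (RtoC f * b + RtoC g * c)
    / RtoC (inner (point_quad x y) (Quad 0 f g h)))%C)
    by (rewrite <- hF'; field; exact EFC).
  assert (hb : qb P = (b - RtoC x * qa P)%C) by (unfold b; ring).
  assert (hc : qc P = (c - RtoC y * qa P)%C) by (unfold c; ring).
  clearbody b c.
  assert (conclude : forall s, c = (b * s)%C -> same_cpoint (N s) P).
  { intros s cs; exists b; split.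
    - intro b0; apply nz.
      rewrite b0 in *; rewrite cs in *.
      assert (a0 : qa P = RtoC 0) by (rewrite ha; field; exact EFC).
      rewrite a0 in *.
      apply quad_extC; simpl; [exact a0 | rewrite hb | rewrite hc | rewrite hE', hb, hc];
        ring.
    - apply quad_extC; cbn [qa qb qc qd]; rewrite ?hE', ?hb, ?hc, ha, cs;
        unfold N, isotropic_normal; cbv zeta; cbn [qa qb qc qd]; field; exact EFC. }
  destruct (Ceq_dec (c - b * Ci)%C (RtoC 0)) as [z | nz1].
  - left; apply conclude, Cminus_eq0, z.
  - destruct (Ceq_dec (c - b * - Ci)%C (RtoC 0)) as [z | nz2].
    + right; apply conclude, Cminus_eq0, z.
    + exfalso; apply (Cmult_neq_0 _ _ nz1 nz2); rewrite <- sq.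
      transitivity (c * c - b * b * (Ci * Ci))%C; [ring |].
      rewrite Ci_square; ring.
Qed.

End Isotropic_normal.

(** * The pencil of solutions *)

Lemma independent_unit K L :
  oriented K -> oriented L -> inner K L ^ 2 <> 1 -> independent K L.
Proof.
  rewrite !oriented_inner; intros HK HL ne l m e.
  assert (zero : forall M, inner (Quad 0 0 0 0) M = 0)
    by (intro M; unfold inner; simpl; field).
  assert (eK := inner_lincomb_l l K m L K); assert (eL := inner_lincomb_l l K m L L).
  rewrite e, zero in eK, eL; rewrite HK, (inner_sym L K) in eK; rewrite HL in eL.
  assert (ml : m * (1 - inner K L ^ 2) = 0).
  { transitivity ((l * inner K L + m * 1) - inner K L * (l * 1 + m * inner K L));
      [ring | rewrite <- eK, <- eL; ring]. }
  apply Rmult_integral in ml; destruct ml as [m0 | k]; [| exfalso; lra].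
  rewrite m0 in eK; split; lra.
Qed.

(** A plane of curves containing an isotropic vector it is not orthogonal to has
    signature (1,1), so its two common points are not real.  Its unit vectors
    with coefficient [t] on [F] are found from [2 a t (E.F) + t^2 (F.F) = 1]; the
    pencil is generated by those for [t = 1] and [t = 2], whose inner product is
    [(1 / 2 + 2) / 2 = 5 / 4]. *)
Lemma isotropic_plane_hyperbolic x y f g h (S : quad R -> Prop) :
  let E := point_quad x y in
  let F := Quad 0 f g h in
  inner E F <> 0 ->
  (forall X, S X <-> oriented X /\ exists a t, X = lincomb a E t F) ->
  hyperbolic_pencil S.
Proof.
  intros E F EF HS.
  assert (EE : inner E E = 0) by apply inner_point.
  set (K := lincomb ((1 - inner F F) / (2 * inner E F)) E 1 F).
  set (L := lincomb ((1 - 4 * inner F F) / (4 * inner E F)) E 2 F).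
  assert (HK : oriented K).
  { apply oriented_inner; unfold K; rewrite inner_lincomb, EE; field; exact EF. }
  assert (HL : oriented L).
  { apply oriented_inner; unfold L; rewrite inner_lincomb, EE; field; exact EF. }
  assert (KL : inner K L = 5 / 4).
  { unfold K, L; rewrite inner_lincomb, EE; field; exact EF. }
  assert (SK : S K) by (apply HS; split; [exact HK | do 2 eexists; reflexivity]).
  assert (SL : S L) by (apply HS; split; [exact HL | do 2 eexists; reflexivity]).
  (* The coefficients invert the 2 x 2 matrix of K, L over E, F, whose
     determinant is - 3 / (4 (E.F)). *)
  assert (basis : forall a t, exists l m, lincomb a E t F = lincomb l K m L).
  { intros a t.
    set (m := (t * ((1 - inner F F) / (2 * inner E F)) - a) * (4 * inner E F / 3)).
    exists (t - 2 * m), m; unfold m, K, L.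
    apply quad_ext; cbn [lincomb qa qb qc qd]; field; exact EF. }
  split.
  - exists K, L; split; [exact HK |]; split; [exact HL |]; split.
    + apply independent_unit; [exact HK | exact HL | rewrite KL; lra].
    + intro X; rewrite HS; split; intros (HX & p & q & e); split; try exact HX.
      * rewrite e; apply basis.
      * exists (p * ((1 - inner F F) / (2 * inner E F))
                + q * ((1 - 4 * inner F F) / (4 * inner E F))), (p * 1 + q * 2).
        rewrite e; unfold K, L.
        apply quad_ext; cbn [lincomb qa qb qc qd]; ring.
  - assert (common : forall X, (forall K0, S K0 -> incident K0 X) <->
      incident E X /\ incident F X).
    { intro X; split.
      - intro all.
        assert (span : forall a t, incident (lincomb a E t F) X).
        { intros a t; destruct (basis a t) as (l & m & ->).
          apply incident_lincomb; apply all; assumption. }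
        split; [replace E with (lincomb 1 E 0 F) | replace F with (lincomb 0 E 1 F)];
          try apply span; apply quad_ext; cbn [lincomb qa qb qc qd]; ring.
      - intros (hE & hF) K0 (_ & a & t & ->)%HS.
        apply incident_lincomb; assumption. }
    assert (scaled : forall K0 P X, same_cpoint P X -> incident K0 P -> incident K0 X).
    { unfold incident; intros K0 P X (z & _ & ->) i; cbn [qa qb qc qd].
      transitivity (z * RtoC 0)%C; [rewrite <- i |]; ring. }
    assert (neg : (- Ci * - Ci = - RtoC 1)%C) by (rewrite <- Ci_square; ring).
    exists (isotropic_normal x y f g h Ci), (isotropic_normal x y f g h (- Ci)%C).
    split; [exact (isotropic_normal_cpoint _ _ _ _ _ EF _ Ci_square) |].
    split; [exact (isotropic_normal_cpoint _ _ _ _ _ EF _ neg) |].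
    split.
    { apply isotropic_normal_neq; intro e; apply (f_equal Im) in e; simpl in e; lra. }
    split; [| split; apply isotropic_normal_not_real; simpl; lra].
    intros X HX; rewrite common; split.
    + intros (hE & hF); exact (isotropic_normal_all _ _ _ _ _ EF _ HX hE hF).
    + intros [s | s]; split; apply (scaled _ _ _ s);
        apply (isotropic_normal_incident _ _ _ _ _ EF).
Qed.

Lemma half_sum_inverse_gt1 t1 t2 :
  t1 <> 0 -> t2 <> 0 -> Rabs t1 <> Rabs t2 ->
  Rabs (/ 2 * (t1 / t2 + t2 / t1)) > 1.
Proof.
  intros n1 n2 ne.
  pose proof (Rabs_pos_lt _ n1) as p1; pose proof (Rabs_pos_lt _ n2) as p2.
  replace (/ 2 * (t1 / t2 + t2 / t1)) with ((t1 ^ 2 + t2 ^ 2) / (2 * (t1 * t2)))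
    by (field; split; assumption).
  rewrite Rabs_div, (Rabs_pos_eq (t1 ^ 2 + t2 ^ 2)), !Rabs_mult, (Rabs_pos_eq 2)
    by nra.
  rewrite <- (pow2_abs t1), <- (pow2_abs t2).
  apply (Rmult_lt_reg_r (2 * (Rabs t1 * Rabs t2))); [nra |].
  unfold Rdiv; rewrite Rmult_assoc, Rinv_l by nra.
  assert (0 < (Rabs t1 - Rabs t2) ^ 2) by (apply pow2_gt_0; lra).
  nra.
Qed.

Theorem mainTheorem5 :
  forall K1 K2 K3 : quad R,
    oriented K1 -> oriented K2 -> oriented K3 ->
    ~ (is_line K1 /\ is_line K2 /\ is_line K3) ->
    (exists! p : R * R, on_curve K1 p /\ on_curve K2 p /\ on_curve K3 p) ->
    Delta4 K1 K2 K3 <> 0 ->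
    tripleU K1 K2 K3 = 0 /\
    (* The equation for a0, free of denominators: no condition on V or t. *)
    (forall (t : R) (K0 : quad R),
       isogonal K1 K2 K3 t K0 <->
       2 * tripleV K1 K2 K3 * t * qa K0 =
         tripleG K1 K2 K3 * t ^ 2 - / 4 * Delta4 K1 K2 K3 ^ 2 /\
       bcd_relations K1 K2 K3 t K0) /\
    (* The same as a quotient, whenever its denominator does not vanish. *)
    (forall (t : R) (K0 : quad R),
       2 * tripleV K1 K2 K3 * t <> 0 ->
       (isogonal K1 K2 K3 t K0 <->
        qa K0 = (tripleG K1 K2 K3 * t ^ 2 - / 4 * Delta4 K1 K2 K3 ^ 2)
                / (2 * tripleV K1 K2 K3 * t) /\
        bcd_relations K1 K2 K3 t K0)) /\
    (forall (t : R) (K0 : quad R), isogonal K1 K2 K3 t K0 -> t <> 0) /\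
    (forall (t1 t2 : R) (K L : quad R),
       isogonal K1 K2 K3 t1 K -> isogonal K1 K2 K3 t2 L ->
       cos_angle K L = / 2 * (t1 / t2 + t2 / t1)) /\
    (* t1 = t2 and t1 = - t2 correspond to one curve, up to its orientation. *)
    (forall (t1 t2 : R) (K L : quad R),
       isogonal K1 K2 K3 t1 K -> isogonal K1 K2 K3 t2 L ->
       Rabs t1 <> Rabs t2 -> Rabs (cos_angle K L) > 1) /\
    (tripleV K1 K2 K3 <> 0 ->
     hyperbolic_pencil (fun K0 => exists t : R, isogonal K1 K2 K3 t K0)).
Proof.
  intros K1 K2 K3 O1 O2 O3 _ ((x, y) & (h1 & h2 & h3) & _) D0.
  unfold on_curve in h1, h2, h3; cbn [fst snd] in h1, h2, h3.
  set (E := point_quad x y); set (F := slope_quad K1 K2 K3).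
  pose proof (tripleV_det _ _ _ O1 O2 O3) as V.
  pose proof (tripleG_det _ _ _ O1 O2 O3) as G.
  pose proof (tripleU_normal _ _ _ O1 O2 O3) as U.
  pose proof (normal_common_point _ _ _ _ _ h1 h2 h3) as (n2 & n3 & n1).
  rewrite n2, n3 in V; rewrite n1, n2, n3 in U.
  assert (EE : inner E E = 0) by apply inner_point.
  assert (EF : inner E F = - 4 * tripleV K1 K2 K3 / Delta4 K1 K2 K3 ^ 2).
  { rewrite V; unfold inner, E, F, point_quad, slope_quad; cbn [qa qb qc qd].
    field; exact D0. }
  assert (FF : inner F F = 4 * tripleG K1 K2 K3 / Delta4 K1 K2 K3 ^ 2).
  { rewrite G; unfold inner, F, slope_quad; cbn [qa qb qc qd]; field; exact D0. }
  assert (span : forall t K0, isogonal K1 K2 K3 t K0 <->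
    oriented K0 /\ K0 = lincomb (qa K0) E t F).
  { intros t K0; unfold isogonal; rewrite !cos_angle_inner.
    rewrite (cramer _ _ _ _ _ D0), (isogonal_span _ _ _ x y) by assumption.
    reflexivity. }
  assert (norm : forall a t, inner (lincomb a E t F) (lincomb a E t F) =
    2 * a * t * inner E F + t ^ 2 * inner F F)
    by (intros a t; rewrite inner_lincomb, EE; ring).
  assert (unit : forall a t, oriented (lincomb a E t F) <->
    2 * tripleV K1 K2 K3 * t * a =
    tripleG K1 K2 K3 * t ^ 2 - / 4 * Delta4 K1 K2 K3 ^ 2).
  { intros a t.
    assert (e : (inner (lincomb a E t F) (lincomb a E t F) - 1)
                * (Delta4 K1 K2 K3 ^ 2 / 4) =
      tripleG K1 K2 K3 * t ^ 2 - / 4 * Delta4 K1 K2 K3 ^ 2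
      - 2 * tripleV K1 K2 K3 * t * a)
      by (rewrite norm, EF, FF; field; exact D0).
    pose proof (pow_nonzero _ 2 D0) as D2.
    rewrite oriented_inner; split; intro k.
    - rewrite k in e; lra.
    - rewrite k in e; apply Rminus_diag_uniq.
      apply (Rmult_eq_reg_r (Delta4 K1 K2 K3 ^ 2 / 4)); lra. }
  assert (main : forall t K0, isogonal K1 K2 K3 t K0 <->
    2 * tripleV K1 K2 K3 * t * qa K0 =
      tripleG K1 K2 K3 * t ^ 2 - / 4 * Delta4 K1 K2 K3 ^ 2 /\
    bcd_relations K1 K2 K3 t K0).
  { intros t K0; rewrite span, (isogonal_span _ _ _ x y) by assumption.
    rewrite <- unit; split; intros (p & e); split; try exact e.
    - rewrite <- e; exact p.
    - rewrite e; exact p. }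
  assert (tnz : forall t K0, isogonal K1 K2 K3 t K0 -> t <> 0).
  { intros t K0 (p & _)%main ->.
    pose proof (pow_nonzero _ 2 D0) as D2; lra. }
  assert (angle : forall t1 t2 K L,
    isogonal K1 K2 K3 t1 K -> isogonal K1 K2 K3 t2 L ->
    cos_angle K L = / 2 * (t1 / t2 + t2 / t1)).
  { intros t1 t2 K L I1 I2.
    pose proof (tnz _ _ I1) as z1; pose proof (tnz _ _ I2) as z2.
    apply span in I1; destruct I1 as (o1 & e1).
    apply span in I2; destruct I2 as (o2 & e2).
    rewrite e1, oriented_inner, norm in o1; rewrite e2, oriented_inner, norm in o2.
    assert (b1 : qa K * inner E F = (1 - t1 ^ 2 * inner F F) / (2 * t1))
      by (rewrite <- o1; field; exact z1).
    assert (b2 : qa L * inner E F = (1 - t2 ^ 2 * inner F F) / (2 * t2))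
      by (rewrite <- o2; field; exact z2).
    rewrite cos_angle_inner, e1, e2, inner_lincomb, EE.
    transitivity (t2 * (qa K * inner E F) + t1 * (qa L * inner E F)
                  + t1 * t2 * inner F F); [ring |].
    rewrite b1, b2; field; split; assumption. }
  split; [| split; [exact main | split; [| split; [exact tnz | split; [exact angle |
    split]]]]].
  - assert (U0 : 4 * tripleU K1 K2 K3 = 0) by (rewrite U; ring); lra.
  - intros t K0 nz; rewrite main; split; intros (p & q); split; try exact q.
    + rewrite <- p; field; split; intro k; apply nz; rewrite k; ring.
    + rewrite p; field; split; intro k; apply nz; rewrite k; ring.
  - intros t1 t2 K L I1 I2 ne; rewrite (angle _ _ _ _ I1 I2).
    apply half_sum_inverse_gt1; eauto.
  - intro V0; unfold F, slope_quad in *.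
    eapply (isotropic_plane_hyperbolic x y).
    + fold E; rewrite EF; unfold Rdiv.
      apply Rmult_integral_contrapositive_currified; [lra |].
      apply Rinv_neq_0_compat, pow_nonzero, D0.
    + intro X; split.
      * intros (t & (o & e)%span); split; [exact o |].
        exists (qa X), t; exact e.
      * intros (o & a & t & e); exists t; apply span; split; [exact o |].
        (* The first entries of E and F are 1 and 0. *)
        replace (qa X) with a by (rewrite e; simpl; ring); exact e.
Qed.
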